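(* Let $P_0,P_1$ be probability measures on a measurable space $(\mathcal X,\mathcal B_{\mathcal X})$ with $P_1\ll P_0$ and $\mathrm{KL}(P_1\|P_0)<\infty$, and let $R=\frac{dP_1}{dP_0}:\mathcal X\to[0,\infty)$. Let $E:\mathcal X\to[0,\infty]$ be measurable with $\mathbb E_{P_0}[E]\le1$, let $s\in(0,\infty)$, and set $\beta:=\frac1{1+s}\in(0,1)$ (equivalently $s=\frac{1-\beta}\beta$). Put $Z_\beta:=\mathbb E_{P_0}[R^\beta]$. Then $$-\log\mathbb E_{P_1}\big[E^{-s}\big]\ \le\ -\frac1\beta\log Z_\beta,$$ with equality if and only if $E=R^\beta/Z_\beta$ $P_0$-a.s.
   Context: Conventions: natural log, $\log(+\infty)=+\infty$ (so the left side is $-\infty$ when $\mathbb E_{P_1}[E^{-s}]=\infty$); for $s>0$, $0^{-s}=+\infty$ and $(+\infty)^{-s}=0$. *)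

(* Defs.v *)
From HB Require Import structures.
From mathcomp Require Import all_boot all_order all_algebra.
From mathcomp Require Import all_classical all_reals all_analysis.
From mathcomp Require Import measurable_realfun.

Set Implicit Arguments.
Unset Strict Implicit.
Unset Printing Implicit Defensive.

Import Order.TTheory GRing.Theory Num.Theory.
Import numFieldNormedType.Exports.

Local Open Scope classical_set_scope.
Local Open Scope ring_scope.
Local Open Scope ereal_scope.
Local Open Scope charge_scope.

(* x ^ (- s) for x in [0, +oo] and s > 0, with 0 ^ (- s) = +oo and
   (+oo) ^ (- s) = 0.  The inverse is the one of \bar R, for which 0^-1 = +oo
   and +oo^-1 = 0; the library's x `^ (- s) is not usable here because it sends
   0 to 0 and +oo to +oo. *)
Definition inv_poweR (R : realType) (x : \bar R) (s : R) : \bar R :=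
  (x `^ s)^-1.

(* The library derivative 'd P1 '/d P0 is one particular version, which may be
   negative on a P0-null set; rho is any measurable version with values in
   [0, +oo[. *)
Definition is_density (d : measure_display) (T : measurableType d)
    (R : realType) (P1 P0 : probability T R) (rho : T -> R) : Prop :=
  [/\ measurable_fun [set: T] rho,
      (forall x, 0 <= rho x)%R &
      \forall x \ae P0, (rho x)%:E = ('d (charge_of_finite_measure P1) '/d P0) x].

(* lne 0 = -oo, but the derivative vanishes only on a P-null set; the negative
   part of the integrand is always P-integrable, so the integral is
   well defined in ]-oo, +oo]. *)
Definition KL (d : measure_display) (T : measurableType d)
    (R : realType) (P Q : probability T R) : \bar R :=
  if `[< P `<< Q >]
  then \int[P]_x lne (('d (charge_of_finite_measure P) '/d Q) x)
  else +oo.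

(* Main.v *)
Require Import Defs.
From HB Require Import structures.
From mathcomp Require Import all_boot all_order all_algebra.
From mathcomp Require Import all_classical all_reals all_analysis.
From mathcomp Require Import measurable_realfun.
From mathcomp Require Import lra.

Import Order.TTheory GRing.Theory Num.Theory.
Import numFieldNormedType.Exports.

Local Open Scope classical_set_scope.
Local Open Scope ring_scope.
Local Open Scope ereal_scope.

(** Let [w := rho ^ beta / Z], which has [P0]-mean 1 and satisfies
    [w ^ (1 + s) = rho / Z ^ (1 + s)].  The tangent inequality
    [(1 + s) w <= w ^ (1 + s) e ^ - s + s e], an equality only at [e = w],
    applied to [e = E x] and integrated against [P0], reads
    [1 + s <= Z ^ - (1 + s) E_P1[E ^ - s] + s E_P0[E]].  Since [E_P0[E] <= 1],
    this gives [Z ^ (1 + s) <= E_P1[E ^ - s]], with equality only if the tangent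
    inequality is an equality [P0]-almost everywhere. *)

Lemma inv_poweR_ge0 (R : realType) (x : \bar R) (s : R) : 0 <= inv_poweR x s.
Proof. by rewrite /inv_poweR inve_ge0 poweR_ge0. Qed.

(** Only [x = 0] needs its own branch: at [+oo], [fine] returns 0, and the real power of 0 with the
    nonzero exponent [- s] is 0 by default, which is the intended value. *)
Lemma inv_poweRE (R : realType) (x : \bar R) (s : R) : 0 <= x -> (0 < s)%R ->
  inv_poweR x s = if x == 0 then +oo else (fine x `^ (- s))%:E.
Proof.
move=> x0 s0; have sn0 : s != 0%R by rewrite gt_eqF.
case: x x0 => [r| |//] r0; rewrite /inv_poweR /=.
  by rewrite inver powR_eq0 sn0 andbT eqe; case: ifP => //; rewrite powRN.
by rewrite (negbTE sn0) invey powR0// oppr_eq0.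
Qed.

Lemma measurable_inv_poweR d (T : measurableType d) (R : realType)
    (E : T -> \bar R) (s : R) : measurable_fun [set: T] E ->
  (forall x, 0 <= E x) -> (0 < s)%R ->
  measurable_fun [set: T] (fun x => inv_poweR (E x) s).
Proof.
move=> mE E0 s0; under eq_fun do rewrite inv_poweRE//.
apply: measurable_fun_ifT => //; first exact: measurable_fun_eqe.
apply/measurable_EFinP; apply: (measurableT_comp (measurable_powR _)).
exact: measurableT_comp.
Qed.

(* [t ^ - s + s t >= 1 - s ln t + s t >= 1 + s]. *)
Lemma powRN_tangent (R : realType) (s t : R) : (0 < s -> 0 < t ->
  1 + s <= t `^ (- s) + s * t ?= iff (t == 1))%R.
Proof.
move=> s0 t0; have le1 := @expR_ge1Dx R (ln t); rewrite lnK// in le1.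
have powE : (t `^ (- s) = expR (- s * ln t))%R by rewrite /powR gt_eqF.
have le2 := @expR_ge1Dx R (- s * ln t)%R; rewrite -powE in le2.
split; first by nra.
apply/eqP/eqP => [eq1|->]; last by rewrite powR1 mulr1.
(* Both links of the chain must be equalities, but [1 + ln t < t] is strict unless [ln t = 0]. *)
apply/eqP; rewrite -ln_eq0//; apply/negP => /negP lnt0.
by have := expR_gt1Dx lnt0; rewrite lnK// => lt1; nra.
Qed.

(** Both sides are homogeneous of degree 1 in [(w, e)], so for positive finite arguments division by
    [w] reduces the claim to [powRN_tangent] at [t = e / w]. If [w > 0] and [e] is 0 or [+oo], the
    right side is [+oo] and the inequality is strict. *)
Lemma inv_poweR_tangent (R : realType) (w s : R) (e : \bar R) :
  (0 <= w)%R -> 0 <= e -> (0 < s)%R ->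
  (((1 + s) * w)%:E <= ((w `^ (1 + s))%:E * inv_poweR e s + s%:E * e)%E
    ?= iff (e == w%:E))%O.
Proof.
move=> w0 e0 s0; have s10 : (1 + s != 0)%R by rewrite gt_eqF// ltr_wpDl.
rewrite inv_poweRE//; move: w0; rewrite le_eqVlt => /predU1P[<-|w0].
  (* For [w = 0] the product is 0 even where [inv_poweR e s] is [+oo]; the remaining [s * e]
     vanishes exactly at [e = 0]. *)
  rewrite powR0// mul0e add0e mulr0; split.
    by rewrite mule_ge0// lee_fin ltW.
  by rewrite eq_sym mule_eq0 eqe gt_eqF.
have pw0 : (0 < w `^ (1 + s))%R by rewrite powR_gt0.
case: e e0 => [e| |//] e0 /=; last first.
  by rewrite gt0_muley ?lte_fin// addey//; split; rewrite ?leey.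
rewrite !eqe; case: eqVneq => [->|en0].
  rewrite gt0_muley ?lte_fin// mule0 adde0.
  by split; rewrite ?leey// (lt_eqF w0).
have {}e0 : (0 < e)%R by rewrite lt_neqAle eq_sym en0.
have t0 : (0 < e / w)%R by rewrite divr_gt0.
have -> : (w `^ (1 + s))%:E * (e `^ (- s))%:E + s%:E * e%:E =
    (((e / w) `^ (- s) + s * (e / w)) * w)%:E.
  rewrite -!EFinM -EFinD; congr _%:E; rewrite mulrDl -!mulrA mulVf ?gt_eqF//.
  rewrite mulr1 (powRM _ (ltW e0)) ?invr_ge0 ?ltW//; congr (_ + _)%R.
  rewrite -(powR_inv1 (ltW w0)) -powRrM mulN1r opprK mulrC -mulrA.
  by rewrite (@powRD _ w) ?(negbTE s10)// powRr1 ?ltW// (mulrC w).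
have [le1 eq1] := powRN_tangent _ _ _ s0 t0.
split; first by rewrite lee_fin ler_pM2r.
have wn0 := lt0r_neq0 w0; rewrite eqe (inj_eq (mulIf wn0)) eq1.
by rewrite -(inj_eq (mulIf wn0)) divfK// mul1r.
Qed.

(** The integral bound makes [f] integrable too, so [f - g] is a nonnegative function with integral
    0. A point where [f] is [+oo] cannot satisfy [f - g = 0], since [g] is finite. *)
Lemma le_integral_ae_eq d (T : measurableType d) (R : realType)
    (mu : {measure set T -> \bar R}) (f : T -> \bar R) (g : T -> R) :
  measurable_fun [set: T] f -> mu.-integrable [set: T] (EFin \o g) ->
  (forall x, 0 <= g x)%R -> (forall x, (g x)%:E <= f x) ->
  \int[mu]_x f x <= \int[mu]_x (g x)%:E ->
  ae_eq mu [set: T] f (EFin \o g).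
Proof.
move=> mf ig g0 gf fg; have mg := measurable_int _ ig.
have f0 x : 0 <= f x by apply: le_trans (gf x); rewrite lee_fin.
have goo : \int[mu]_x (g x)%:E < +oo.
  have /integrableP[_] := ig.
  by under eq_integral do rewrite gee0_abs ?lee_fin//.
have ifoo : mu.-integrable [set: T] f.
  apply/integrableP; split => //; under eq_integral do rewrite gee0_abs//.
  exact: le_lt_trans fg goo.
have mfg : measurable_fun [set: T] (fun x => f x - (g x)%:E).
  exact: emeasurable_funB.
have : \int[mu]_x `|f x - (g x)%:E| = 0.
  under eq_integral do rewrite gee0_abs ?sube_ge0//.
  rewrite integralB//; apply/eqP; rewrite eq_le sube_le0 fg/= suber_ge0.
    by apply: ge0_le_integral => // x _; rewrite lee_fin.
  by rewrite ge0_fin_numE ?goo// integral_ge0// => x _; rewrite lee_fin.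
move/(ae_eq_integral_abs _ measurableT mfg); apply: filterS => x /(_ I) /= + _.
by case: (f x) => //= r [] /eqP; rewrite subr_eq0 => /eqP ->.
Qed.

(** The change of variables is known for [Radon_Nikodym_SigmaFinite.f], which agrees [P0]-almost
    everywhere with the derivative of the charge, hence with [rho]. *)
Lemma integral_density d (T : measurableType d) (R : realType)
    (P0 P1 : probability T R) (rho : T -> R) (f : T -> \bar R) :
  P1 `<< P0 -> is_density P1 P0 rho -> measurable_fun [set: T] f ->
  (forall x, 0 <= f x) ->
  \int[P1]_x f x = \int[P0]_x ((rho x)%:E * f x).
Proof.
move=> P10 [mrho rho0 rhoE] mf f0.
rewrite -(Radon_Nikodym_SigmaFinite.change_of_variables P10)//.
have mRN := measurable_int _ (Radon_Nikodym_SigmaFinite.f_integrable P10).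
apply: ae_eq_integral => //.
- exact: emeasurable_funM.
- by apply: emeasurable_funM => //; exact/measurable_EFinP.
have := ae_eq_Radon_Nikodym_SigmaFinite P10 measurableT.
apply: filterS2 rhoE => x -> /(_ I) -> _.
by rewrite muleC.
Qed.

(** Finiteness comes from [rho ^ b <= 1 + rho]. A zero mean would force [rho = 0] almost everywhere,
    whereas [rho] has mean [P1 setT = 1]. *)
Lemma mean_powR_fin_num d (T : measurableType d) (R : realType)
    (P0 P1 : probability T R) (rho : T -> R) (b : R) :
  P1 `<< P0 -> is_density P1 P0 rho -> (0 < b <= 1)%R ->
  exists2 z : R, (0 < z)%R & \int[P0]_x (rho x `^ b)%:E = z%:E.
Proof.
move=> P10 dens /andP[b0 b1]; have [mrho rho0 _] := dens.
have mrhob : measurable_fun [set: T] (fun x => (rho x `^ b)%:E).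
  by apply/measurable_EFinP; exact: (measurableT_comp (measurable_powR _)).
have rho1 : \int[P0]_x (rho x)%:E = 1.
  transitivity (\int[P1]_x cst 1 x); last first.
    by rewrite integral_cst// mul1e; exact: probability_setT.
  rewrite (integral_density _ _ _ _ _ _ _ P10 dens)//.
  by under [RHS]eq_integral do rewrite mule1.
have I0 : 0 <= \int[P0]_x (rho x `^ b)%:E.
  by apply: integral_ge0 => x _; rewrite lee_fin powR_ge0.
have Ioo : \int[P0]_x (rho x `^ b)%:E < +oo.
  apply: (@le_lt_trans _ _ (\int[P0]_x (1 + (rho x)%:E))).
    apply: ge0_le_integral => //.
    - by move=> x _; rewrite lee_fin powR_ge0.
    - by apply: emeasurable_funD => //; exact/measurable_EFinP.
    - move=> x _; rewrite -EFinD lee_fin; have [le1|/ltW ge1] := leP (rho x) 1%R.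
        apply: (@le_trans _ _ 1%R); last by rewrite lerDl.
        have := ge0_ler_powR (ltW b0); move/(_ (rho x) 1%R).
        by rewrite powR1 !nnegrE; apply.
      by apply: (le_trans (ler1_powR ge1 b1)); rewrite lerDr.
  rewrite ge0_integralD//; first last.
  - exact/measurable_EFinP.
  - by move=> x _; rewrite lee_fin.
  by rewrite integral_cst//= mul1e rho1 [X in X + _](@probability_setT _ _ _ P0) -EFinD ltey.
have I_neq0 : \int[P0]_x (rho x `^ b)%:E != 0.
  apply/eqP => int0; suff : \int[P0]_x (rho x)%:E = 0.
    by rewrite rho1 => /eqP; rewrite onee_eq0.
  rewrite -[RHS](integral0 P0 [set: T]); apply: ae_eq_integral => //.
    exact/measurable_EFinP.
  have /(ae_eq_integral_abs _ measurableT mrhob) : \int[P0]_x `|(rho x `^ b)%:E| = 0.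
    by under eq_integral do rewrite gee0_abs ?lee_fin ?powR_ge0//.
  by apply: filterS => x + _ => /(_ I) [] /powR_eq0_eq0 /= ->.
exists (fine (\int[P0]_x (rho x `^ b)%:E)); last by rewrite fineK// ge0_fin_numE.
by rewrite fine_gt0// Ioo andbT lt_neqAle eq_sym I_neq0.
Qed.

Theorem theorem4p10 (d : measure_display) (T : measurableType d) (R : realType)
    (P0 P1 : probability T R) (rho : T -> R) (E : T -> \bar R) (s : R)
    (P1_ac_P0 : P1 `<< P0)
    (KL_fin : KL P1 P0 < +oo)
    (rho_density : is_density P1 P0 rho)
    (E_meas : measurable_fun [set: T] E)
    (E_ge0 : forall x, 0 <= E x)
    (E_le1 : \int[P0]_x E x <= 1)
    (s_gt0 : (0 < s)%R) :
  let beta : R := ((1 + s)^-1)%R in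
  let Z : \bar R := 'E_P0[fun x => (rho x `^ beta)%R] in
  - lne (\int[P1]_x inv_poweR (E x) s) <= - ((beta^-1)%:E * lne Z)
  /\ (- lne (\int[P1]_x inv_poweR (E x) s) = - ((beta^-1)%:E * lne Z)
      <-> \forall x \ae P0, E x = ((rho x `^ beta)%R)%:E / Z).
Proof.
move=> beta Z; have s1_gt0 : (0 < 1 + s)%R by rewrite ltr_wpDl.
have [mrho rho0 _] := rho_density.
have [z z0 ZE] : exists2 z : R, (0 < z)%R & Z = z%:E.
  rewrite /Z unlock; apply: (mean_powR_fin_num _ _ _ _ _ _ _ P1_ac_P0 rho_density).
  by rewrite invr_gt0 s1_gt0 invf_le1// lerDl ltW.
have z_neq0 := lt0r_neq0 z0.
pose w x := (rho x `^ beta / z)%R.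
have w0 x : (0 <= w x)%R by rewrite divr_ge0 ?powR_ge0// ltW.
have mrhob : measurable_fun [set: T] (fun x => rho x `^ beta)%R.
  exact: (measurableT_comp (measurable_powR _)).
have mw : measurable_fun [set: T] w by exact: measurable_funM.
have int_w : \int[P0]_x (w x)%:E = 1.
  under eq_integral do rewrite EFinM.
  rewrite ge0_integralZr//; first last.
  - by rewrite lee_fin invr_ge0 ltW.
  - by move=> x _; rewrite lee_fin powR_ge0.
  - exact/measurable_EFinP.
  by move: ZE; rewrite /Z unlock => IZ; rewrite [X in X * _]IZ -EFinM divff.
pose k : R := (z `^ (1 + s))%R.
have k0 : (0 < k)%R by rewrite powR_gt0.
(* The choice of [beta] gives [beta * (1 + s) = 1], so a multiple of the density appears and the
   first term of [F] integrates to a multiple of [A]. *)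
have wE x : (w x `^ (1 + s) = k^-1 * rho x)%R.
  rewrite powRM ?powR_ge0 ?invr_ge0 ?ltW// -powRrM mulVf ?gt_eqF// powRr1//.
  by rewrite -(powR_inv1 (ltW z0)) -powRrM mulN1r powRN mulrC.
pose A := \int[P1]_x inv_poweR (E x) s.
have mEs := measurable_inv_poweR _ _ _ _ _ E_meas E_ge0 s_gt0.
have A0 : 0 <= A by apply: integral_ge0 => x _; exact: inv_poweR_ge0.
pose F x := (w x `^ (1 + s))%:E * inv_poweR (E x) s + s%:E * E x.
pose G x := ((1 + s) * w x)%R.
have mF : measurable_fun [set: T] F.
  apply: emeasurable_funD; last exact: measurable_funeM.
  apply: emeasurable_funM => //; apply/measurable_EFinP.
  exact: (measurableT_comp (measurable_powR _)).
have GF x : (((G x)%:E <= F x ?= iff (E x == (w x)%:E))%O).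
  exact: inv_poweR_tangent.
have int_F : \int[P0]_x F x = k^-1%:E * A + s%:E * \int[P0]_x E x.
  rewrite ge0_integralD//; first last.
  - exact: measurable_funeM.
  - by move=> x _; rewrite mule_ge0// lee_fin ltW.
  - apply: emeasurable_funM => //; apply/measurable_EFinP.
    exact: (measurableT_comp (measurable_powR _)).
  - by move=> x _; rewrite mule_ge0 ?inv_poweR_ge0// lee_fin powR_ge0.
  rewrite ge0_integralZl ?lee_fin// ?ltW//; congr (_ + _).
  rewrite /A (integral_density _ _ _ _ _ _ _ P1_ac_P0 rho_density)//; last first.
    by move=> x; exact: inv_poweR_ge0.
  rewrite -ge0_integralZl//; first last.
  - by rewrite lee_fin invr_ge0 ltW.
  - by move=> x _; rewrite mule_ge0 ?inv_poweR_ge0// lee_fin.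
  - by apply: emeasurable_funM => //; exact/measurable_EFinP.
  by apply: eq_integral => x _; rewrite wE EFinM muleA.
have G0 x : (0 <= G x)%R by rewrite mulr_ge0// ltW.
have mG : measurable_fun [set: T] (EFin \o G).
  by apply/measurable_EFinP; exact: measurable_funM.
have int_G : \int[P0]_x (G x)%:E = (1 + s)%:E.
  under eq_integral do rewrite EFinM.
  rewrite ge0_integralZl//; first by rewrite int_w mule1.
  - exact/measurable_EFinP.
  - by move=> x _; rewrite lee_fin.
  - by rewrite lee_fin ltW.
have iG : P0.-integrable [set: T] (EFin \o G).
  apply/integrableP; split => //.
  under eq_integral do rewrite gee0_abs ?lee_fin//.
  by rewrite int_G ltey.
have int_FE1 : \int[P0]_x F x <= k^-1%:E * A + s%:E.
  by rewrite int_F leeD2l// -[leRHS]mule1 lee_wpmul2l// lee_fin ltW.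
(* Valid also for [A = +oo], because [k] is a positive real. *)
have AE : A = k%:E * (k^-1%:E * A).
  by rewrite muleA -EFinM divff ?mul1e// lt0r_neq0.
(* Integrating [G <= F] gives [1 + s <= k^-1 * A + s]; the finite term [s] cancels even if [A] is
   infinite. *)
have k_le_A : k%:E <= A.
  have : \int[P0]_x (G x)%:E <= k^-1%:E * A + s%:E.
    apply: le_trans int_FE1; apply: ge0_le_integral => //.
    - by move=> x _; rewrite lee_fin.
    - by move=> x _; exact: (GF x).1.
  rewrite int_G EFinD leeD2rE// => le1.
  by rewrite AE -[leLHS]mule1 lee_wpmul2l// lee_fin ltW.
have lnk : (beta^-1)%:E * lne Z = lne k%:E.
  by rewrite ZE !lne_EFin// -EFinM ln_powR invrK.
have A_itv : A \in `[0, +oo] by rewrite in_itv/= A0 leey.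
have k_itv : k%:E \in `[0, +oo] by rewrite in_itv/= lee_fin ltW// leey.
rewrite lnk -/A leeN2; split; first by rewrite lee_lne.
(* [lne] is injective on [[0, +oo]], so equality of the logarithms is equality of their
   arguments. *)
transitivity (A = k%:E).
  split=> [/oppe_inj lnA|->//].
  exact: lne_inj lnA.
have wZ x : (rho x `^ beta)%:E / Z = (w x)%:E.
  by rewrite ZE inver (negbTE z_neq0) -EFinM.
have kA : k^-1%:E * k%:E = 1 by rewrite -EFinM mulVf// lt0r_neq0.
split=> [Ak|Ew].
  (* With [A = k] the bound [int_FE1] becomes [1 + s], the integral of [G]; as [G <= F], the two
     agree almost everywhere, and the equality case of the tangent inequality gives [E = w]. *)
  have FG : \int[P0]_x F x <= \int[P0]_x (G x)%:E.
    by rewrite int_G EFinD -kA -Ak.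
  have F_ge x : (G x)%:E <= F x := (GF x).1.
  have := le_integral_ae_eq _ _ _ _ _ _ mF iG G0 F_ge FG.
  apply: filterS => x /(_ I) /= FGx.
  by rewrite wZ; apply/eqP; rewrite -(GF x).2 FGx.
(* Conversely, [E = w] almost everywhere makes the mean of [E] exactly 1 and [F = G], so that
   [k^-1 * A + s = 1 + s]. *)
have intE : \int[P0]_x E x = 1.
  rewrite -int_w; apply: ae_eq_integral => //; first exact/measurable_EFinP.
  by apply: filterS Ew => x + _; rewrite wZ.
have : \int[P0]_x F x = (1 + s)%:E.
  rewrite -int_G; apply: ae_eq_integral => //.
  by apply: filterS Ew => x; rewrite wZ => /eqP + _; rewrite -(GF x).2 => /eqP.
rewrite int_F intE mule1 EFinD => /(congr1 (fun y => y - s%:E)).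
by rewrite !addeK// => kA1; rewrite AE kA1 mule1.
Qed.
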